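(* Let $d\in\mathbb N$ and let $H$ be an irreducible positively recurrent stochastic graph. Let $\pi_k:\bar H_{a_k}\to H$, $k=1,2$, be two (graph skew product) $d$-extensions of $H$ generated by functions $a_1,a_2:H\to\mathcal A_d$, respectively, and let the functions $A_k:X_H\to\mathcal A_d$, $k=1,2$, be defined by $$A_k(x)=a_k(x_1)^{-1},\qquad x=(x_n)_{n=1}^\infty\in X_H.$$ Then the following two conditions are equivalent: (i) $A_1$ and $A_2$ are cohomologous with respect to $T_H$, i.e. there exists a measurable map $W:X_H\to\mathcal A_d$ such that $A_2(x)\cdot W(x)=W(T_Hx)\cdot A_1(x)$ for (a.e.) $x\in X_H$; (ii) $a_1$ and $a_2$ are cohomologous with respect to $H$, i.e. there exists a map $w:H^{(0)}\to\mathcal A_d$ such that $a_2(h)\cdot w(s(h))=w(t(h))\cdot a_1(h)$ for all $h\in H$.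
   Context: A stochastic graph $(H,p)$ is a directed graph with countable (finite or infinite) edge set $H$, vertex set $H^{(0)}$, start and terminal maps $s,t:H\to H^{(0)}$, such that $H_u=\{h:s(h)=u\}$ and ${}_vH=\{h:t(h)=v\}$ are nonempty for all vertices, with weights $p(h)>0$ satisfying $\sum_{h\in H_u}p(h)=1$ for every $u$. Positive recurrence: there are stationary probabilities $p^{(0)}(u)>0$ with $\sum_u p^{(0)}(u)=1$ and $\sum_{h\in {}_vH}p(h)p^{(0)}(s(h))=p^{(0)}(v)$ for all $v$. $H$ is irreducible if for all vertices $u,v$ there are $h_1,\dots,h_n\in H$ with $s(h_k)=t(h_{k+1})$, $s(h_n)=u$, $t(h_1)=v$. Let $X_H=\{(x_n)_{n\ge1}\in H^{\mathbb N}: s(x_n)=t(x_{n+1})\ \forall n\}$, with probability measure $m_H(x_1=h_1,\dots,x_n=h_n)=p(h_1)\cdots p(h_n)p^{(0)}(s(h_n))$ on cylinders; $T_H(x_n)=(x_{n+1})$ is the one-sided Markov shift. $\mathcal A_d$ is the group of all permutations of $Y_d=\{1,\dots,d\}$. For $a:H\to\mathcal A_d$, the graph skew product $\bar H_a$ is the stochastic graph with edges $H\times Y_d$, vertices $H^{(0)}\times Y_d$, $s(h,y)=(s(h),y)$, $t(h,y)=(t(h),a(h)y)$, $p(h,y)=p(h)$, and $\bar H_a\to H$, $(h,y)\mapsto h$, is the natural projection. *)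

(* Defs.v *)
From HB Require Import structures.
From mathcomp Require Import all_boot all_order all_algebra all_fingroup.
From mathcomp Require Import all_classical all_reals all_analysis.

Set Implicit Arguments.
Unset Strict Implicit.
Unset Printing Implicit Defensive.

Import Order.TTheory GRing.Theory Num.Theory.

Local Open Scope classical_set_scope.
Local Open Scope ring_scope.

Record stochGraph (R : realType) := StochGraph {
  edge : countType;
  vert : choiceType;
  src : edge -> vert;
  tgt : edge -> vert;
  wt : edge -> R;
  src_surj : forall u, exists h, src h = u;
  tgt_surj : forall v, exists h, tgt h = v;
  wt_gt0 : forall h, 0 < wt h;
  wt_sum : forall u, (\esum_(h in [set h | src h = u]) (wt h)%:E = 1)%E
}.

Arguments src {R s}.
Arguments tgt {R s}.
Arguments wt {R s}.

(* Positive recurrence carries its stationary probabilities as data; on an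
   irreducible graph they are unique. *)
Record posRecGraph (R : realType) := PosRecGraph {
  pr_graph :> stochGraph R;
  stat : vert pr_graph -> R;
  stat_gt0 : forall u, 0 < stat u;
  stat_sum : (\esum_(u in [set: vert pr_graph]) (stat u)%:E = 1)%E;
  stat_eq : forall v,
    (\esum_(h in [set h : edge pr_graph | tgt h = v])
       (wt h * stat (src h))%:E = (stat v)%:E)%E
}.

Arguments stat {R p}.

(* Edges compose backwards: each edge starts where the next one ends.  The
   word under consideration is h 0, ..., h n; other values of h are ignored. *)
Definition walk (R : realType) (H : stochGraph R) (n : nat)
    (h : nat -> edge H) : Prop :=
  forall k, (k < n)%N -> src (h k) = tgt (h k.+1).

Definition irreducible_graph (R : realType) (H : stochGraph R) : Prop :=
  forall u v : vert H, exists (n : nat) (h : nat -> edge H),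
    [/\ walk n h, src (h n) = u & tgt (h 0%N) = v].

(* Positive recurrence guarantees the point that a measurable type requires.
   Sequences are indexed from 0: the first coordinate of x is x 0. *)
Record path_of (R : realType) (H : posRecGraph R) := PathOf {
  path_fun :> nat -> edge H;
  path_walk : forall n, src (path_fun n) = tgt (path_fun n.+1)
}.

HB.instance Definition _ (R : realType) (H : posRecGraph R) :=
  gen_eqMixin (path_of H).
HB.instance Definition _ (R : realType) (H : posRecGraph R) :=
  gen_choiceMixin (path_of H).

Lemma exists_path (R : realType) (H : posRecGraph R) :
  exists _ : path_of H, True.
Proof.
have [u _] : exists u : vert H, True.
  apply: contrapT => nV; have := stat_sum H.
  rewrite (_ : [set: vert H] = set0); last first.
    by rewrite -subset0 => u _; apply: nV; exists u.
  by rewrite esum_set0 => /eqP; rewrite eq_sym onee_eq0.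
have [f fE] := choice (@tgt_surj R H).
pose x n := f (iter n (src \o f) u).
have xw n : src (x n) = tgt (x n.+1) by rewrite /x fE.
by exists (PathOf xw).
Qed.

Definition path0 (R : realType) (H : posRecGraph R) : path_of H :=
  projT1 (cid (exists_path H)).

HB.instance Definition _ (R : realType) (H : posRecGraph R) :=
  isPointed.Build (path_of H) (path0 H).

Definition cylinder (R : realType) (H : posRecGraph R) (n : nat)
    (h : nat -> edge H) : set (path_of H) :=
  [set x : path_of H | forall k, (k <= n)%N -> x k = h k].

Definition cylinders (R : realType) (H : posRecGraph R) :
    set (set (path_of H)) :=
  [set C | exists (n : nat) (h : nat -> edge H), C = cylinder n h].

Definition pathSpace (R : realType) (H : posRecGraph R) :=
  g_sigma_algebraType (@cylinders R H).

Definition path_shift (R : realType) (H : posRecGraph R) (x : pathSpace H) :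
    pathSpace H :=
  @PathOf R H (fun n => x n.+1) (fun n => path_walk x n.+1).

(* These values determine m, since cylinders form a pi-system up to set0.  The
   formula is required only of walks: other cylinders are empty. *)
Definition markov_measure (R : realType) (H : posRecGraph R)
    (m : probability (pathSpace H) R) : Prop :=
  forall (n : nat) (h : nat -> edge H), walk n h ->
    m (cylinder n h) =
      ((\prod_(k < n.+1) wt (h k)) * stat (src (h n)))%:E.

HB.instance Definition _ (T : finType) := isPointed.Build (perm_type T) 1%g.
HB.instance Definition _ (T : finType) :=
  @isMeasurable.Build default_measure_display (perm_type T)
    discrete_measurable (@discrete_measurable0 _)
    (@discrete_measurableC _) (@discrete_measurableU _).

(* Product of permutations acting on the left; MathComp's (f * g)%g applies f
   first. *)
Definition perm_comp (d : nat) (f g : 'S_d) : 'S_d := (g * f)%g.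
Notation "f \oS g" := (perm_comp f g) (at level 50, left associativity).

Lemma perm_compE (d : nat) (f g : 'S_d) (y : 'I_d) : (f \oS g) y = f (g y).
Proof. by rewrite /perm_comp permM. Qed.

Section SkewProduct.
Context (R : realType) (H : stochGraph R) (d : nat) (a : edge H -> 'S_d).

Let sE := (edge H * 'I_d)%type : countType.
Let sV := (vert H * 'I_d)%type : choiceType.

Definition skew_src (e : sE) : sV := (src e.1, e.2).
Definition skew_tgt (e : sE) : sV := (tgt e.1, a e.1 e.2).
Definition skew_wt (e : sE) : R := wt e.1.

Lemma skew_src_surj u : exists e, skew_src e = u.
Proof. by case: u => u y; have [h <-] := src_surj u; exists (h, y). Qed.

Lemma skew_tgt_surj v : exists e, skew_tgt e = v.
Proof.
case: v => v y; have [h <-] := tgt_surj v.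
by exists (h, ((a h)^-1)%g y); rewrite /skew_tgt /= permKV.
Qed.

Lemma skew_wt_gt0 e : 0 < skew_wt e.
Proof. exact: wt_gt0. Qed.

Lemma skew_wt_sum u :
  (\esum_(e in [set e | skew_src e = u]) (skew_wt e)%:E = 1)%E.
Proof.
case: u => u y; rewrite -(wt_sum u).
rewrite (@reindex_esum R _ _ [set h : edge H | src h = u] _ (fun h => (h, y)))//.
split.
- by move=> h /= <-.
- by move=> h h' _ _ [].
- by move=> [h z] /= [<- <-]; exists h.
Qed.

Definition skewGraph : stochGraph R :=
  StochGraph skew_src_surj skew_tgt_surj skew_wt_gt0 skew_wt_sum.

Definition skew_proj (e : edge skewGraph) : edge H := e.1.

End SkewProduct.

Definition edge_cocycle (R : realType) (H : posRecGraph R) (d : nat)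
    (a : edge H -> 'S_d) (x : pathSpace H) : 'S_d := ((a (x 0%N))^-1)%g.

Definition shift_cohomologous (R : realType) (H : posRecGraph R)
    (m : probability (pathSpace H) R) (d : nat)
    (A1 A2 : pathSpace H -> 'S_d) : Prop :=
  exists W : pathSpace H -> 'S_d, measurable_fun [set: pathSpace H] W /\
    \forall x \ae m, A2 x \oS W x = W (path_shift x) \oS A1 x.

Definition graph_cohomologous (R : realType) (H : stochGraph R) (d : nat)
    (a1 a2 : edge H -> 'S_d) : Prop :=
  exists w : vert H -> 'S_d,
    forall h, a2 h \oS w (src h) = w (tgt h) \oS a1 h.

(* Main.v *)
Require Import Defs.
From mathcomp Require Import all_boot all_order all_algebra all_fingroup.
From mathcomp Require Import all_classical all_reals all_analysis.
From mathcomp Require Import ring.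

(* A vertex map w gives the transfer function x |-> w (t(x_1)).  Conversely, let
   W be a transfer function and F_u(g) the conditional probability of W = g
   given t(x_1) = u.  Since W(Tx) = rho_{x_1}(W(x)) for permutations rho_h of
   the fibre, F_v(g) is an average of the F_{s(h)}(rho_h(g)) over the edges h
   ending at v.  Stationarity makes the mean of |F_u|^2 equal on both
   sides, so equality holds in Jensen's inequality and
   F_{s(h)}(rho_h(g)) = F_{t(h)}(g) for every edge h.  Iterating, {W = g} is
   conditionally independent of every cylinder given t(x_1) = u, hence of
   itself, and F_u is a Dirac mass at some w(u). *)

Set Implicit Arguments.
Unset Strict Implicit.
Unset Printing Implicit Defensive.

Import Order.TTheory GRing.Theory Num.Theory.

Local Open Scope classical_set_scope.
Local Open Scope ring_scope.

(** * Unordered sums of nonnegative families, and rigidity of harmonic functions *)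

Lemma esumZl (R : realType) (T : choiceType) (I : set T) (r : R)
    (a : T -> \bar R) : 0 <= r -> (forall i, (0 <= a i)%E) ->
  (\esum_(i in I) (r%:E * a i) = r%:E * \esum_(i in I) a i)%E.
Proof.
move=> r0 a0; rewrite /esum -ereal_supZl//; last first.
  apply/set0P; exists 0%E; exists set0; first exact: fsets_set0.
  by rewrite fsbig_set0.
rewrite image_comp; congr ereal_sup; apply: eq_imagel => X _ /=.
by rewrite ge0_mule_fsumr.
Qed.

Lemma esum_fibers (R : realType) (T U : choiceType) (t : T -> U)
    (a : T -> \bar R) : (forall i, (0 <= a i)%E) ->
  (\esum_(i in [set: T]) a i =
   \esum_(u in [set: U]) \esum_(i in [set i | t i = u]) a i)%E.
Proof.
move=> a0; rewrite esum_esum//.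
rewrite (@reindex_esum _ _ _ ([set: U] `*`` (fun u => [set i | t i = u]))
  [set: T] snd)//; split => //.
- by move=> [u i] [u' i'] /[!inE] -[/= _ <-] [/= _ <-] ->.
- by move=> i _; exists (t i, i).
Qed.

(** Equality case of Jensen's inequality, by expanding squares: the weighted sum over the edges [h]
    of the squared distance between [F (src h) \o rho h] and [F (tgt h)] is [E - 2E + E = 0], where
    [E] is the stationary mean of [|F u|^2]. *)
Lemma harmonic_rigid (R : realType) (H : posRecGraph R) (Y : finType)
    (rho : edge H -> Y -> Y) (F : vert H -> Y -> R) :
  (forall h, injective (rho h)) -> (forall u y, 0 <= F u y <= 1) ->
  (forall u y, \esum_(h in [set h : edge H | tgt h = u])
      (wt h * stat (src h) * F (src h) (rho h y))%:E = (stat u * F u y)%:E)%E ->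
  forall h y, F (src h) (rho h y) = F (tgt h) y.
Proof.
move=> rhoI F01 harm.
have F0 u y : 0 <= F u y by case/andP: (F01 u y).
(* [c h] is the mass of the edge [h]: the edges leaving [u] and the edges entering [u] both have
   total mass [stat u]. *)
pose c (h : edge H) : R := wt h * stat (src h).
have c0 h : 0 < c h by rewrite mulr_gt0 ?wt_gt0 ?stat_gt0.
pose phi u := \sum_y F u y ^+ 2.
have phi0 u : 0 <= phi u by apply: sumr_ge0 => y _; exact: sqr_ge0.
pose X (h : edge H) := \sum_y F (src h) (rho h y) ^+ 2.
(* An injective self-map of the finite [Y] is a permutation, so it preserves the norm. *)
have XE h : X h = phi (src h).
  by rewrite /phi (reindex_inj (@rhoI h)).
pose Z (h : edge H) := \sum_y F (src h) (rho h y) * F (tgt h) y.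
have Z0 h : 0 <= Z h by apply: sumr_ge0 => y _; exact: mulr_ge0.
pose D (h : edge H) := \sum_y (F (src h) (rho h y) - F (tgt h) y) ^+ 2.
have D0 h : 0 <= D h by apply: sumr_ge0 => y _; exact: sqr_ge0.
have XYZD h : X h + phi (tgt h) = D h + (Z h + Z h).
  rewrite -!big_split/=; apply: eq_bigr => y _; ring.
set E : \bar R := (\esum_(u in [set: vert H]) (stat u * phi u)%:E)%E.
have Efin : (E < +oo)%E.
  apply: (@le_lt_trans _ _ (\esum_(u in [set: vert H])
     (#|Y|%:R%:E * (stat u)%:E))%E); last first.
    rewrite esumZl ?stat_sum ?mule1 ?ltry// => u.
    by rewrite lee_fin ltW ?stat_gt0.
  apply: le_esum => u _.
  rewrite -EFinM lee_fin mulrC ler_wpM2r ?(ltW (stat_gt0 _))//.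
  have -> : #|Y|%:R = \sum_(y : Y) 1 :> R by rewrite sumr_const.
  rewrite /phi; apply: ler_sum => y _.
  by rewrite expr_le1//; case/andP: (F01 u y).
have E0 : (0 <= E)%E.
  by apply: esum_ge0 => u _; rewrite lee_fin mulr_ge0// ltW ?stat_gt0.
have sX : (\esum_(h in [set: edge H]) (c h * X h)%:E = E)%E.
  rewrite (esum_fibers src) => [|h]; last first.
    by rewrite lee_fin mulr_ge0 ?XE// ltW.
  apply: eq_esum => u _.
  rewrite -[RHS]mule1 -(wt_sum u) -esumZl ?mulr_ge0 ?(ltW (stat_gt0 _))//.
    by apply: eq_esum => h <-; rewrite XE -EFinM /c; congr EFin; ring.
  by move=> h; rewrite lee_fin ltW ?wt_gt0.
have sY : (\esum_(h in [set: edge H]) (c h * phi (tgt h))%:E = E)%E.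
  rewrite (esum_fibers tgt) => [|h]; last by rewrite lee_fin mulr_ge0// ltW.
  apply: eq_esum => u _.
  rewrite mulrC EFinM -stat_eq -esumZl//.
    by apply: eq_esum => h <-; rewrite -EFinM /c; congr EFin; ring.
  by move=> h; rewrite lee_fin ltW ?mulr_gt0 ?wt_gt0 ?stat_gt0.
(* Grouping the cross terms by target lets the harmonicity of [F] replace the average over incoming
   edges by [F u y]. *)
have sZ : (\esum_(h in [set: edge H]) (c h * Z h)%:E = E)%E.
  rewrite (esum_fibers tgt) => [|h]; last by rewrite lee_fin mulr_ge0// ltW.
  apply: eq_esum => u _.
  transitivity (\esum_(h in [set h : edge H | tgt h = u])
      \sum_y (F u y)%:E * (c h * F (src h) (rho h y))%:E)%E.
    apply: eq_esum => h /= <-; rewrite /Z mulr_sumr -sumEFin.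
    by apply: eq_bigr => y _; rewrite -EFinM; congr EFin; ring.
  rewrite esum_sum => [|h y _ _]; last first.
    rewrite -EFinM lee_fin.
    by rewrite !mulr_ge0 ?F0 ?(ltW (wt_gt0 _)) ?(ltW (stat_gt0 _)).
  rewrite /phi mulr_sumr -sumEFin; apply: eq_bigr => y _.
  rewrite esumZl//; first by rewrite harm -EFinM; congr EFin; ring.
  move=> h; rewrite lee_fin.
  by rewrite !mulr_ge0 ?F0 ?(ltW (wt_gt0 _)) ?(ltW (stat_gt0 _)).
have cM0 h (x : R) : 0 <= x -> (0 <= (c h * x)%:E)%E.
  by move=> x0; rewrite lee_fin mulr_ge0// ltW.
have sD : (\esum_(h in [set: edge H]) (c h * D h)%:E = 0)%E.
  (* Finiteness of [E] is what allows [E + E] to be cancelled. *)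
  have EE : (E + E = \esum_(h in [set: edge H]) (c h * D h)%:E + (E + E))%E.
    rewrite -{1}sX -{1}sY -sZ -!esumD;
      try by move=> h _; rewrite ?adde_ge0 ?cM0// XE.
    by apply: eq_esum => h _; rewrite -!EFinD -!mulrDr XYZD.
  have Ef : (E + E)%E \is a fin_num by rewrite fin_numD ge0_fin_numE// Efin.
  by rewrite -[LHS](addeK _ Ef) -EE subee.
move=> h y.
have : D h = 0.
  have /eqP : ((c h * D h)%:E = 0)%E.
    apply/eqP; rewrite eq_le cM0// andbT -sD.
    rewrite -(@esum_set1 R _ h (fun h => (c h * D h)%:E))// ?cM0//.
    by apply: esum_ge; exists [set h]; [|rewrite fsbig_set1 esum_set1 ?cM0].
  by rewrite eqe mulf_eq0 gt_eqF//= => /eqP.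
move/eqP; rewrite psumr_eq0 => [|z _]; last exact: sqr_ge0.
by move/allP/(_ y); rewrite mem_index_enum sqrf_eq0 subr_eq0 => /(_ isT)/eqP.
Qed.

(** Countable additivity over [nat], transported along [pickle]. *)
Lemma measure_bigcup_esum (R : realType) (dX : measure_display)
    (X : measurableType dX) (mu : {measure set X -> \bar R}) (I : countType)
    (D : set I) (F : I -> set X) :
  (forall i, D i -> measurable (F i)) -> trivIset D F ->
  mu (\bigcup_(i in D) F i) = (\esum_(i in D) mu (F i))%E.
Proof.
move=> mF tF; pose G n := oapp F set0 (unpickle n).
have Gp i : G (pickle i) = F i by rewrite /G pickleK.
have -> : \bigcup_(i in D) F i = \bigcup_(n in pickle @` D) G n.
  by rewrite bigcup_image; apply: eq_bigcupr => i _; rewrite Gp.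
rewrite measure_bigcup.
- rewrite nneseries_esum => [|n _]; last exact: measure_ge0.
  rewrite (_ : [set x | _] = pickle @` D); last first.
    by apply/seteqP; split => n /=; rewrite inE.
  rewrite (@reindex_esum _ _ _ D _ pickle).
    by apply: eq_esum => i _; rewrite Gp.
  by apply: inj_bij => i j _ _; apply: (pcan_inj pickleK).
- by move=> _ [i Di <-]; rewrite Gp; exact: mF.
- by move=> _ _ [i Di <-] [j Dj <-]; rewrite !Gp => /(tF _ _ Di Dj) ->.
Qed.

(** * Measurable sets of paths, and measures determined by cylinders *)

Section PathSpace.
Context (R : realType) (H : posRecGraph R).
Implicit Types (x y : pathSpace H) (h : edge H) (k : nat -> edge H).

Lemma measurable_cylinder n k :
  measurable (@cylinder R H n k : set (pathSpace H)).
Proof. by apply: sub_sigma_algebra; exists n, k. Qed.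

(** There are countably many finite words, so such a set is the countable union of the cylinders it
    contains that are given by words. *)
Lemma measurable_initial n (A : set (pathSpace H)) :
  (forall x y, (forall i, (i <= n)%N -> x i = y i) -> A x -> A y) ->
  measurable A.
Proof.
move=> Aloc; pose e := path0 H 0%N.
have -> : A = \bigcup_(s : seq (edge H))
    if `[< cylinder n (nth e s) `<=` A >] then cylinder n (nth e s) else set0.
  apply/seteqP; split => x.
    move=> Ax; exists (mkseq x n.+1) => //.
    have xs i : (i <= n)%N -> nth e (mkseq x n.+1) i = x i.
      by move=> ni; rewrite nth_mkseq.
    rewrite asboolT; first by move=> i ni; rewrite xs.
    by move=> y /= yx; apply: Aloc Ax => i ni; rewrite yx// xs.
  by move=> [s _]; case: asboolP => // sA /sA.
apply: countable_bigcupT_measurable => // s.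
by case: asboolP => _ //; exact: measurable_cylinder.
Qed.

Lemma measurable_coord (P : set (edge H)) :
  measurable [set x : pathSpace H | P (x 0%N)].
Proof. by apply: (@measurable_initial 0%N) => x y /= /(_ 0%N) ->. Qed.

Lemma measurable_shift : measurable_fun [set: pathSpace H] (@path_shift R H).
Proof.
apply: (@measurability _ _ (pathSpace H) (pathSpace H) _ _ (@cylinders R H)) => //.
move=> _ [_ [n [k ->]] <-].
rewrite setTI; apply: (@measurable_initial n.+1) => x y xy kx i ni /=.
by rewrite -xy//; exact: kx.
Qed.

Definition ends_at (u : vert H) : set (pathSpace H) :=
  [set x | tgt (x 0%N) = u].

Definition first_edge h : set (pathSpace H) := [set x | x 0%N = h].

Lemma measurable_ends_at u : measurable (ends_at u).
Proof. exact: (measurable_coord [set h | tgt h = u]). Qed.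

Lemma measurable_first_edge h : measurable (first_edge h).
Proof. exact: (measurable_coord [set h' | h' = h]). Qed.

Lemma first_edge_cylinder h : first_edge h = cylinder 0 (fun=> h).
Proof.
apply/seteqP; split => x /=; last exact.
by move=> xh [|].
Qed.

Lemma trivIset_first_edge (D : set (edge H)) (B : set (pathSpace H)) :
  trivIset D (fun h => first_edge h `&` B).
Proof. by move=> h h' _ _ [x [[<- _] [<- _]]]. Qed.

Lemma bigcup_first_edge (D : set (edge H)) (B : set (pathSpace H)) :
  [set x : pathSpace H | D (x 0%N)] `&` B =
  \bigcup_(h in D) (first_edge h `&` B).
Proof.
apply/seteqP; split => x; first by case=> Dx Bx; exists (x 0%N).
by move=> [h Dh [xh Bx]]; split=> //=; rewrite xh.
Qed.

Lemma cylinder_nonwalk n k : ~ walk n k -> @cylinder R H n k = set0.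
Proof.
move=> nw; rewrite -subset0 => x xk; apply: nw => i ni.
by rewrite -!xk// 1?ltnW// path_walk.
Qed.

(** Any common point [z] supplies the word, read up to the longer of the two lengths. *)
Lemma cylinderI n k n' k' :
  (@cylinder R H n k `&` cylinder n' k' = set0) \/
  exists N K, @cylinder R H n k `&` cylinder n' k' = cylinder N K.
Proof.
have [->|/set0P[z [zk zk']]] := eqVneq (cylinder n k `&` cylinder n' k') set0.
  by left.
right; exists (maxn n n'), z; apply/seteqP; split => x /=.
  move=> [xk xk'] i; rewrite leq_max => /orP[ni|ni].
    by rewrite xk// zk.
  by rewrite xk'// zk'.
move=> xz; split => i ni; rewrite xz ?leq_max ?ni ?orbT//.
  exact: zk.
exact: zk'.
Qed.

(** Uniqueness of finite measures on a generating pi-system. Walks suffice, because the other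
    cylinders are empty. *)
Lemma path_measure_unique (mu nu : {measure set (pathSpace H) -> \bar R}) :
  (mu setT < +oo)%E -> mu setT = nu setT ->
  (forall n k, walk n k -> mu (cylinder n k) = nu (cylinder n k)) ->
  forall B : set (pathSpace H), measurable B -> mu B = nu B.
Proof.
move=> muoo muT muc.
(* Unless some word is not a walk, the empty set is not a cylinder. *)
pose G := [set A | @cylinders R H A \/ A = set0 \/ A = setT].
have mG : (measurable : set (set (pathSpace H))) = <<s G >>.
  apply/seteqP; split => A.
    apply: smallest_sub; first exact: smallest_sigma_algebra.
    by move=> B cB; apply: sub_sigma_algebra; left.
  apply: smallest_sub; first exact: smallest_sigma_algebra.
  move=> B [|[->|->]]; [exact: sub_sigma_algebra| |].
    exact: (@measurable0 _ (pathSpace H)).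
  exact: (@measurableT _ (pathSpace H)).
apply: (@measure_unique _ R (pathSpace H) G (fun=> setT) mG _ _ _ mu nu).
- move=> A B [[n [k ->]]|[->|->]] [[n' [k' ->]]|[->|->]];
    rewrite ?set0I ?setI0 ?setTI ?setIT; try by [right; left|right; right].
  + have [->|[N [K ->]]] := cylinderI n k n' k'; first by right; left.
    by left; exists N, K.
  + by left; exists n, k.
  + by left; exists n', k'.
- by move=> _; right; right.
- by rewrite bigcup_const//; exists 0%N.
- move=> A [[n [k ->]]|[->|->]]; rewrite ?measure0//.
  have [w|w] := pselect (walk n k); first exact: muc.
  by rewrite cylinder_nonwalk ?measure0.
- by [].
Qed.
End PathSpace.

(** * The Markov property of the path measure *)

Section Markov.
Context (R : realType) (H : posRecGraph R) (m : probability (pathSpace H) R).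
Hypothesis m_markov : markov_measure m.
Implicit Types (h : edge H) (k : nat -> edge H) (B : set (pathSpace H)).

Lemma markov_first_edge h : m (first_edge h) = (wt h * stat (src h))%:E.
Proof. by rewrite first_edge_cylinder m_markov// big_ord1. Qed.

Lemma markov_bigcup (D : set (edge H)) B : measurable B ->
  m ([set x : pathSpace H | D (x 0%N)] `&` B) =
  (\esum_(h in D) m (first_edge h `&` B))%E.
Proof.
move=> mB; rewrite bigcup_first_edge measure_bigcup_esum//.
  by move=> h _; apply: measurableI => //; exact: measurable_first_edge.
exact: trivIset_first_edge.
Qed.

(** Splitting by the first edge turns this into the stationarity equation at [u]. *)
Lemma markov_ends_at u : m (ends_at u) = (stat u)%:E.
Proof.
rewrite -[ends_at u]setIT.
rewrite [LHS](markov_bigcup [set h | tgt h = u] measurableT) -stat_eq.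
by apply: eq_esum => h _; rewrite setIT markov_first_edge.
Qed.

Lemma cylinderS n k :
  cylinder n.+1 k =
    first_edge (k 0%N) `&` @path_shift R H @^-1` (cylinder n (fun i => k i.+1)).
Proof.
apply/seteqP; split => x /=.
  by move=> xk; split; [exact: xk|move=> i ni; exact: xk].
by move=> [x0 xk] [|i]; [move=> _; exact: x0|exact: xk].
Qed.

Lemma cylinder_ends_at n k (u : vert H) : tgt (k 0%N) = u ->
  (cylinder n k : set (pathSpace H)) `<=` ends_at u.
Proof. by move=> <- x xk; rewrite /ends_at/= xk. Qed.

Lemma cylinder_ends_at0 n k (u : vert H) : tgt (k 0%N) <> u ->
  (cylinder n k : set (pathSpace H)) `&` ends_at u = set0.
Proof.
move=> ku; rewrite -subset0 => x [xk]; rewrite /ends_at/= xk//.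
Qed.

(** Both sides are finite measures in [B], so cylinders suffice. Putting [h] in front of a walk that
    ends at [src h] contributes the factor [wt h]; for a walk that ends elsewhere both sides
    vanish. *)
Lemma markov_shift h B : measurable B ->
  m (first_edge h `&` @path_shift R H @^-1` B) =
  ((wt h)%:E * m (B `&` ends_at (src h)))%E.
Proof.
move=> mB; have mT := @measurable_shift R H.
pose r : {nonneg R} := NngNum (ltW (wt_gt0 h)).
(* [mu] is abstracted over the measurability proof that its measure structure
   needs, hence [mu mT] below. *)
pose mu : {measure set (pathSpace H) -> \bar R} :=
  pushforward (mrestr m (measurable_first_edge h)) (@path_shift R H).
pose nu : {measure set (pathSpace H) -> \bar R} :=
  mscale r (mrestr m (measurable_ends_at (src h))).
have muE A : mu mT A = m (@path_shift R H @^-1` A `&` first_edge h) by [].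
have nuE A : nu A = ((wt h)%:E * m (A `&` ends_at (src h)))%E by [].
rewrite setIC; change (mu mT B = nu B).
apply: (@path_measure_unique R H (mu mT) nu) => //.
- by rewrite muE preimage_setT setTI markov_first_edge ltry.
- rewrite muE nuE preimage_setT !setTI.
  by rewrite markov_first_edge markov_ends_at EFinM.
- move=> n k wk; rewrite muE nuE.
  have [kh|kh] := pselect (tgt (k 0%N) = src h).
    rewrite (setIidl (cylinder_ends_at kh)) m_markov// -EFinM mulrA.
    (* [K] is the word [h, k 0, k 1, ...], a walk because [tgt (k 0) = src h]. *)
    pose K i := if i is i'.+1 then k i' else h.
    rewrite setIC -[first_edge h]/(first_edge (K 0%N)) -(cylinderS n K).
    rewrite m_markov; last by move=> [_|i] //=; exact: wk.
    by rewrite big_ord_recl.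
  rewrite cylinder_ends_at0// measure0 mule0 (_ : _ `&` _ = set0) ?measure0//.
  rewrite -subset0 => x [xk xh]; apply: kh.
  by rewrite -xh path_walk; congr tgt; rewrite -xk.
Qed.

End Markov.

(** [A] is contained in the union of [B] with a null set. This carries almost sure relations such as
    [W_shift] over to measures of sets. *)
Lemma ae_le_measure (R : realType) (dX : measure_display)
    (X : measurableType dX) (mu : {measure set X -> \bar R}) (A B : set X) :
  measurable A -> measurable B -> (\forall x \ae mu, A x -> B x) ->
  (mu A <= mu B)%E.
Proof.
move=> mA mB [N [mN N0 AB]].
rewrite -(measureU0 mB mN N0); apply: le_measure; rewrite ?inE//.
  exact: measurableU.
move=> x Ax; apply: contrapT => /not_orP[Bx Nx].
by apply: Nx; apply: AB => /= /(_ Ax).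
Qed.

(** * Level sets of a shift-equivariant function *)

Section ShiftEquivariance.
Context (R : realType) (H : posRecGraph R) (m : probability (pathSpace H) R).
Hypothesis m_markov : markov_measure m.
Context (Y : finType) (rho : edge H -> Y -> Y) (W : pathSpace H -> Y).
Hypothesis rho_inj : forall h, injective (rho h).
Hypothesis mW : forall y, measurable (W @^-1` [set y]).
Hypothesis W_shift : \forall x \ae m, W (path_shift x) = rho (x 0%N) (W x).
Implicit Types (h : edge H) (k : nat -> edge H) (B : set (pathSpace H)).

(** On paths with first edge [h], almost surely [W x = y] exactly when [W (path_shift x) = rho h y],
    by injectivity of [rho h]; the Markov property does the rest. *)
Lemma shift_level_set h B y : measurable B ->
  m (first_edge h `&` (W @^-1` [set y] `&` @path_shift R H @^-1` B)) =
  ((wt h)%:E *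
   m ((B `&` W @^-1` [set rho h y]) `&` ends_at (src h)))%E.
Proof.
move=> mB; rewrite -(markov_shift m_markov h); last exact: measurableI.
have mT C : measurable C -> measurable (@path_shift R H @^-1` C).
  by move=> mC; rewrite -[X in measurable X]setTI; exact: measurable_shift.
have mh := measurable_first_edge h.
apply/eqP; rewrite eq_le; apply/andP; split; apply: ae_le_measure;
  try by apply: measurableI => //; try apply: mT;
    apply: measurableI => //; exact: mT.
  apply: filterS W_shift => x Wx [xh [Wy xB]].
  by split=> //; split=> //=; rewrite Wx xh Wy.
apply: filterS W_shift => x Wx [xh [xB /= Wy]].
by split=> //; split=> //=; apply: (@rho_inj h); rewrite -Wy Wx xh.
Qed.

(** The conditional probability [F_u(y)] of [W = y] given [ends_at u], an event of measure
    [stat u]. *)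
Definition level_prob u y : R :=
  fine (m (ends_at u `&` W @^-1` [set y])) / stat u.

Lemma measurable_ends_at_level u y :
  measurable (ends_at u `&` W @^-1` [set y]).
Proof. by apply: measurableI; [exact: measurable_ends_at|exact: mW]. Qed.

Lemma level_probE u y :
  m (ends_at u `&` W @^-1` [set y]) = (stat u * level_prob u y)%:E.
Proof.
rewrite /level_prob mulrC divfK ?gt_eqF ?stat_gt0// fineK//.
by apply: fin_num_measure; exact: measurable_ends_at_level.
Qed.

Lemma level_prob01 u y : 0 <= level_prob u y <= 1.
Proof.
apply/andP; split.
  by rewrite divr_ge0 ?(ltW (stat_gt0 _))// fine_ge0.
rewrite ler_pdivrMr ?stat_gt0// mul1r -lee_fin fineK; last first.
  by apply: fin_num_measure; exact: measurable_ends_at_level.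
rewrite -(markov_ends_at m_markov) le_measure// ?inE.
- exact: measurable_ends_at_level.
- exact: measurable_ends_at.
Qed.

Lemma first_edge_level h y :
  m (first_edge h `&` W @^-1` [set y]) =
  (wt h * stat (src h) * level_prob (src h) (rho h y))%:E.
Proof.
have := @shift_level_set h setT y measurableT.
rewrite preimage_setT setIT setTI setIC => ->.
by rewrite setIC level_probE -EFinM mulrA.
Qed.

(** Splitting the level set by the first edge shows that [level_prob] is harmonic, so
    [harmonic_rigid] applies. *)
Lemma level_prob_edge h y :
  level_prob (src h) (rho h y) = level_prob (tgt h) y.
Proof.
move: h y; apply: harmonic_rigid rho_inj level_prob01 _ => u y.
rewrite -level_probE [RHS](markov_bigcup m [set h | tgt h = u] (mW y)).
by apply: eq_esum => h _; rewrite first_edge_level.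
Qed.

(** Induction on the length: removing the first edge [h] changes [y] into [rho h y], and
    [level_prob_edge] turns the resulting factor back into the one at [tgt h]. *)
Lemma cylinder_level n k y : walk n k ->
  m (cylinder n k `&` W @^-1` [set y]) =
  (m (cylinder n k) * (level_prob (tgt (k 0%N)) y)%:E)%E.
Proof.
elim: n k y => [|n IHn] k y wk.
  rewrite (_ : cylinder 0 k = first_edge (k 0%N)); last first.
    rewrite first_edge_cylinder; apply/seteqP; split => x xk i.
      by rewrite leqn0 => /eqP ->; exact: xk.
    by rewrite leqn0 => /eqP ->; exact: xk.
  by rewrite first_edge_level markov_first_edge// -EFinM level_prob_edge.
have wk' : walk n (fun i => k i.+1) by move=> i ni; exact: (wk i.+1).
have mk' := @measurable_cylinder R H n (fun i => k i.+1).
have tk : tgt (k 1%N) = src (k 0%N) by rewrite wk.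
rewrite cylinderS -setIA [X in _ `&` X]setIC shift_level_set//.
rewrite markov_shift// setIAC (setIidl (cylinder_ends_at tk)).
by rewrite IHn// tk level_prob_edge muleA.
Qed.

(** Cylinders determine finite measures, so independence passes from them to every measurable [B],
    including the level set itself. *)
Lemma level_independent u y B : measurable B ->
  m (B `&` (ends_at u `&` W @^-1` [set y])) =
  ((level_prob u y)%:E * m (B `&` ends_at u))%E.
Proof.
move=> mB; have /andP[F0 _] := level_prob01 u y.
pose mu : {measure set (pathSpace H) -> \bar R} :=
  mrestr m (measurable_ends_at_level u y).
pose nu : {measure set (pathSpace H) -> \bar R} :=
  mscale (NngNum F0) (mrestr m (measurable_ends_at u)).
have muE A : mu A = m (A `&` (ends_at u `&` W @^-1` [set y])) by [].
have nuE A : nu A = ((level_prob u y)%:E * m (A `&` ends_at u))%E by [].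
rewrite -muE -nuE; apply: path_measure_unique mB.
- by rewrite muE setTI level_probE ltry.
- by rewrite muE nuE !setTI level_probE markov_ends_at// mulrC EFinM.
- move=> n k wk; rewrite muE nuE setIA.
  have [ku|ku] := pselect (tgt (k 0%N) = u).
    by rewrite (setIidl (cylinder_ends_at ku)) cylinder_level// ku muleC.
  by rewrite cylinder_ends_at0// set0I measure0 mule0.
Qed.

(** Taking the event itself for [B] makes it independent of itself, whence [F = F * F]. *)
Lemma level_prob_idem u y : level_prob u y = 0 \/ level_prob u y = 1.
Proof.
have E := level_independent u y (measurable_ends_at_level u y).
rewrite setIid setIAC setIid level_probE -EFinM in E.
case: E; move: (level_prob u y) => F /eqP; rewrite -subr_eq0.
have -> : stat u * F - F * (stat u * F) = stat u * (F * (1 - F)) by ring.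
rewrite !mulf_eq0 gt_eqF ?stat_gt0//= subr_eq0 => /orP[/eqP F0|/eqP F1].
  by left.
by right.
Qed.

(** Otherwise [ends_at u], of positive measure, would be a finite union of null level sets. *)
Lemma level_prob_exists u : exists y, level_prob u y = 1.
Proof.
apply: contrapT => no1.
have := markov_ends_at m_markov u.
rewrite (_ : ends_at u = \bigcup_(y : Y) (ends_at u `&` W @^-1` [set y])).
  rewrite measure_bigcup_esum.
  - rewrite esum1 => [[] /eqP|y _].
      by rewrite lt_eqF// stat_gt0.
    rewrite /= level_probE.
    have [->|e] := level_prob_idem u y; first by rewrite mulr0.
    by case: no1; exists y.
  - by move=> y _; exact: measurable_ends_at_level.
  - by move=> y y' _ _ [x [[_ <-] [_ <-]]].
apply/seteqP; split => x; first by move=> xu; exists (W x).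
by case=> y _ [].
Qed.

(** Two disjoint level sets of full mass would give [ends_at u] measure at least [2 * stat u]. *)
Lemma level_prob_unique u y z :
  level_prob u y = 1 -> level_prob u z = 1 -> y = z.
Proof.
move=> y1 z1; apply: contrapT => yz.
have : (m (ends_at u `&` W @^-1` [set y] `|` ends_at u `&` W @^-1` [set z])
    <= m (ends_at u))%E.
  apply: le_measure; rewrite ?inE.
  - by apply: measurableU; exact: measurable_ends_at_level.
  - exact: measurable_ends_at.
  - by rewrite -setIUr; exact: subIsetl.
rewrite measureU; [|exact: measurable_ends_at_level..|]; last first.
  by rewrite -subset0 => x [[_ Wy] [_ Wz]]; apply: yz; rewrite -Wy -Wz.
rewrite /= !level_probE y1 z1 !mulr1 markov_ends_at// -EFinD lee_fin.
by rewrite gerDl leNgt stat_gt0.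
Qed.

(** [w u] is the value that [W] takes almost surely on [ends_at u]; [level_prob_edge] carries this
    value along [h]. *)
Lemma shift_equivariant_vertex :
  exists w : vert H -> Y, forall h, w (src h) = rho h (w (tgt h)).
Proof.
have [w w1] := choice level_prob_exists.
exists w => h; apply: (@level_prob_unique (src h)) => //.
by rewrite level_prob_edge.
Qed.

End ShiftEquivariance.

(** * Cohomology over the shift and over the graph *)

Theorem theorem4p5 (R : realType) (d : nat) (H : posRecGraph R)
    (H_irr : irreducible_graph H)
    (m : probability (pathSpace H) R) (m_markov : markov_measure m)
    (a1 a2 : edge H -> 'S_d)
    (pi1 : edge (skewGraph a1) -> edge H) (pi1E : pi1 = @skew_proj R H d a1)
    (pi2 : edge (skewGraph a2) -> edge H) (pi2E : pi2 = @skew_proj R H d a2) :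
  shift_cohomologous m (edge_cocycle a1) (edge_cocycle a2) <->
  graph_cohomologous a1 a2.
Proof.
split=> [[W [mW Wc]]|[w wc]].
(* This solves the shift equation for [W (path_shift x)]. In left-action order it is [g] preceded by
   [a1 h] and followed by the inverse of [a2 h]. *)
- pose rho h (g : 'S_d) : 'S_d := (a1 h * g * (a2 h)^-1)%g.
  have [|y||w wE] := @shift_equivariant_vertex R H m m_markov _ rho W.
  + by move=> h g g' /mulIg/mulgI.
  + by rewrite -[X in measurable X]setTI; exact: mW.
  + apply: filterS Wc => x; rewrite /perm_comp /edge_cocycle /rho => Wx.
    by rewrite -mulgA Wx mulKVg.
  exists w => h; rewrite /perm_comp wE /rho.
  by rewrite mulgKV.
- exists (fun x : pathSpace H => w (tgt (x 0%N))); split.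
    move=> _ B _; rewrite setTI.
    exact: (measurable_coord [set h | B (w (tgt h))]).
  (* The first edge of [path_shift x] ends where [x 0] starts, so the shift equation at [x] is the
     graph equation at [x 0] and holds for every path. *)
  apply: aeW => x; rewrite /perm_comp /edge_cocycle /path_shift/=.
  have := wc (x 0%N); rewrite /perm_comp (path_walk x) => xw.
  by rewrite -[w (tgt (x 0%N))](mulKg (a1 (x 0%N))) -xw mulgA mulgK.
Qed.
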